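(* Let $0<r\le R$ and let $\omega\subset\mathbb{R}^d$ be an $(r,R)$-Delone set with finite local complexity, with hull $\varOmega(\omega)$. Then, for each $\varepsilon$ with $0<\varepsilon<\varepsilon_0:=\min\bigl\{\frac{1}{\sqrt2},\frac r2,\frac1{2R}\bigr\}$, one has $H_\varepsilon(\varOmega(\omega),\alpha)=h_{\rm pc}(\omega)$. In particular, $$h_{\rm pc}(\omega)=h_{\rm top}(\varOmega(\omega),\alpha).$$
   Context: $B_S(x)$ is the closed Euclidean ball of radius $S$ around $x\in\mathbb{R}^d$, $B_S=B_S(0)$, and $|\cdot|$ is Lebesgue volume. Delone sets: a subset $\omega\subset\mathbb{R}^d$ is an $(r,R)$-Delone set if every open ball of radius $r$ contains at most one point of $\omega$ and every closed ball of radius $R$ contains at least one point of $\omega$. Let $\mathcal{D}_{r,R}$ be the set of all $(r,R)$-Delone sets. The group $\mathbb{R}^d$ acts on it by $\alpha_x(\omega)=-x+\omega$. Patches: for $D>0$, $p_\omega(D)=\{(-x+\omega)\cap B_D : x\in\omega\}$. The set $\omega$ has finite local complexity (FLC) if $\operatorname{card}(p_\omega(D))<\infty$ for every $D>0$. The patch counting entropy is $h_{\rm pc}(\omega)=\limsup_{n\to\infty}\frac1{|B_n|}\log\bigl(\operatorname{card}(p_\omega(n))\bigr)$. Metric and hull: $\mathcal{D}_{r,R}$ carries the metric $$d(\xi_1,\xi_2)=\min\bigl\{\tfrac1{\sqrt2},\ \inf\{S>0 : \exists\,u,v\in B_S:\ (-u+\xi_1)\cap B_{1/S}=(-v+\xi_2)\cap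 B_{1/S}\}\bigr\},$$ for which the action $\alpha$ is continuous. The hull $\varOmega(\omega)$ is the closure of $\{\alpha_x(\omega):x\in\mathbb{R}^d\}$ in $\mathcal{D}_{r,R}$. It is compact when $\omega$ is FLC. Topological entropy: for $\varOmega=\varOmega(\omega)$, a subset $\varXi\subset\varOmega$ is $(D,\varepsilon)$-separated if for all $\xi_1\ne\xi_2$ in $\varXi$ there is $x\in B_D$ with $d(\alpha_x(\xi_1),\alpha_x(\xi_2))>\varepsilon$. Let $N(D,\varepsilon)$ be the maximal cardinality of a $(D,\varepsilon)$-separated subset of $\varOmega$ (finite by compactness). Put $H_\varepsilon(\varOmega,\alpha)=\limsup_{n\to\infty}\frac1{|B_n|}\log N(n,\varepsilon)$ for $\varepsilon>0$, and $h_{\rm top}(\varOmega,\alpha)=\lim_{\varepsilon\to0}H_\varepsilon(\varOmega,\alpha)$. *)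

(* Defs.v *)
(* [K : realType] is the field of real numbers and R^d is ['rV[K]_d]. *)
From HB Require Import structures.
From mathcomp Require Import all_boot all_order all_algebra.
From mathcomp Require Import all_classical all_reals all_analysis.

Set Implicit Arguments.
Unset Strict Implicit.
Unset Printing Implicit Defensive.

Import Order.TTheory GRing.Theory Num.Theory.
Import numFieldNormedType.Exports.

Local Open Scope classical_set_scope.
Local Open Scope ring_scope.

(* The norm [`|x|] of the library on row vectors is the sup norm, and [ball] and
   [closed_ball] refer to it; Euclidean balls are therefore defined here. *)
Definition enorm (K : realType) (d : nat) (x : 'rV[K]_d) : K :=
  Num.sqrt (\sum_(i < d) x ord0 i ^+ 2).

Definition oball (K : realType) (d : nat) (x : 'rV[K]_d) (S : K) :
  set 'rV[K]_d := [set y | enorm (y - x) < S].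

Definition cball (K : realType) (d : nat) (x : 'rV[K]_d) (S : K) :
  set 'rV[K]_d := [set y | enorm (y - x) <= S].

(* Lebesgue (outer) measure on R^d, for 0 < d: the infimum of the total volume
   of the countable covers by closed boxes with opposite corners [a k <= b k].
   The library provides Lebesgue measure on the line only. *)
Definition lebesgue_volume (K : realType) (d : nat) (A : set 'rV[K]_d) :
    \bar K :=
  ereal_inf [set v : \bar K | exists a b : nat -> 'rV[K]_d,
    [/\ forall k i, a k ord0 i <= b k ord0 i,
        A `<=` \bigcup_k [set x : 'rV[K]_d | forall i,
                                    a k ord0 i <= x ord0 i <= b k ord0 i] &
        v = (\sum_(0 <= k <oo)
               (\prod_(i < d) (b k ord0 i - a k ord0 i))%:E)%E]].

Definition delone (K : realType) (d : nat) (r R : K) (w : set 'rV[K]_d) :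
    Prop :=
  (forall x, is_subset1 (w `&` oball x r)) /\
  (forall x, (w `&` cball x R) !=set0).

(* The action [alpha_x(w) = -x + w]. *)
Definition shift (K : realType) (d : nat) (x : 'rV[K]_d) (w : set 'rV[K]_d) :
  set 'rV[K]_d := [set - x + y | y in w].

Definition patches (K : realType) (d : nat) (w : set 'rV[K]_d) (D : K) :
  set (set 'rV[K]_d) := [set shift x w `&` cball 0 D | x in w].

Definition flc (K : realType) (d : nat) (w : set 'rV[K]_d) : Prop :=
  forall D : K, 0 < D -> finite_set (patches w D).

(* limsup_n |B_n|^-1 log (c n), for cardinalities [c n] in [0, +oo]. *)
Definition log_growth (K : realType) (d : nat) (c : nat -> \bar K) : \bar K :=
  limn_esup (fun n : nat =>
    ((fine (lebesgue_volume (cball (0 : 'rV[K]_d) n%:R)))^-1)%:E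
      * lne (c n))%E.

Definition patch_entropy (K : realType) (d : nat) (w : set 'rV[K]_d) :
    \bar K :=
  log_growth d (fun n => counting (patches w n%:R) : \bar K).

(* The infimum is taken in the extended reals so that the infimum of the empty
   set is [+oo]; the minimum with 1/sqrt 2 is always a real number. *)
Definition delone_dist (K : realType) (d : nat) (xi1 xi2 : set 'rV[K]_d) : K :=
  fine (Order.min ((Num.sqrt 2)^-1)%:E
    (ereal_inf [set S%:E | S in [set S : K | 0 < S /\
      exists u v : 'rV[K]_d,
        [/\ cball 0 S u, cball 0 S v &
            shift u xi1 `&` cball 0 S^-1 = shift v xi2 `&` cball 0 S^-1]]])).

(* The closure of the orbit of [w] in the space of (r,R)-Delone sets with
   metric [delone_dist]. *)
Definition hull (K : realType) (d : nat) (r R : K) (w : set 'rV[K]_d) :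
    set (set 'rV[K]_d) :=
  [set xi | delone r R xi /\
    forall e : K, 0 < e -> exists x, delone_dist xi (shift x w) < e].

Definition separated (K : realType) (d : nat) (D e : K)
    (Xi : set (set 'rV[K]_d)) : Prop :=
  forall xi1 xi2, Xi xi1 -> Xi xi2 -> xi1 <> xi2 ->
    exists2 x, cball 0 D x & e < delone_dist (shift x xi1) (shift x xi2).

Definition sep_number (K : realType) (d : nat) (Om : set (set 'rV[K]_d))
    (D e : K) : \bar K :=
  ereal_sup [set (counting Xi : \bar K) | Xi in
    [set Xi : set (set 'rV[K]_d) | Xi `<=` Om /\ separated D e Xi]].

Definition entropy_at (K : realType) (d : nat) (Om : set (set 'rV[K]_d))
    (e : K) : \bar K :=
  log_growth d (fun n => sep_number Om n%:R e).

Definition top_entropy (K : realType) (d : nat) (Om : set (set 'rV[K]_d)) :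
    \bar K :=
  lim (entropy_at Om e @[e --> 0^'+]).

(* Main.v *)
(* Lower bound: pick, for every patch P of radius n, a translate of w whose patch
   around 0 is P.  If two such translates were e-close along the whole ball B_n,
   the small translations matching them locally could not change from one place
   to the next, because nearby local matchings share a point and the sets are
   uniformly discrete; being trivial at 0, they are trivial on B_n, and the two
   patches coincide.  So these translates are (n,e)-separated.

   Upper bound: an element xi of the hull has a point q in B_R, and its patch of
   radius n + k around q is a patch of w.  This patch and the cell of q in a grid
   of mesh about e determine xi up to (n,e)-closeness, so a separated set has at
   most C card p_w(n + k) elements, where C and k do not depend on n.  Neither the
   factor C nor the shift k affects the exponential growth rate, since
   |B_(n+k)| / |B_n| tends to 1. *)
Require Import Defs.
From mathcomp Require Import all_boot all_order all_algebra.
From mathcomp Require Import all_classical all_reals all_analysis.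
From mathcomp Require Import ring lra.
Import Order.TTheory GRing.Theory Num.Theory.
Import numFieldNormedType.Exports.
(* [shift] and [separated] are also names of the library. *)
Import Defs.

Set Implicit Arguments.
Unset Strict Implicit.
Unset Printing Implicit Defensive.

Local Open Scope classical_set_scope.
Local Open Scope ring_scope.

(** * Euclidean norm on row vectors *)

Section Enorm.
Context {K : realType} {d : nat}.
Implicit Types (x y : 'rV[K]_d) (s : K).

Lemma enorm_ge0 x : 0 <= enorm x.
Proof. exact: sqrtr_ge0. Qed.

Lemma sqr_enorm x : enorm x ^+ 2 = \sum_(i < d) x ord0 i ^+ 2.
Proof. by rewrite sqr_sqrtr// sumr_ge0// => i _; rewrite sqr_ge0. Qed.

Lemma enorm0 : enorm (0 : 'rV[K]_d) = 0.
Proof.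
by rewrite /enorm big1 ?sqrtr0// => i _; rewrite mxE expr0n.
Qed.

Lemma enormZ s x : enorm (s *: x) = `|s| * enorm x.
Proof.
rewrite /enorm -sqrtr_sqr -sqrtrM ?sqr_ge0// mulr_sumr.
by congr Num.sqrt; apply: eq_bigr => i _; rewrite mxE exprMn.
Qed.

Lemma enormN x : enorm (- x) = enorm x.
Proof. by rewrite -scaleN1r enormZ normrN normr1 mul1r. Qed.

Lemma enormB x y : enorm (x - y) = enorm (y - x).
Proof. by rewrite -enormN opprB. Qed.

Lemma coord_le_enorm x i : `|x ord0 i| <= enorm x.
Proof.
rewrite -sqrtr_sqr ler_sqrt; last by rewrite sumr_ge0// => j _; rewrite sqr_ge0.
by rewrite (bigD1 i)//= lerDl sumr_ge0// => j _; rewrite sqr_ge0.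
Qed.

Lemma enorm_eq0 x : enorm x = 0 -> x = 0.
Proof.
move=> x0; apply/rowP => i; rewrite mxE; apply/eqP.
by rewrite -normr_le0 -x0 coord_le_enorm.
Qed.

Lemma enorm_le_coord x s : (forall i, `|x ord0 i| <= s) -> enorm x <= d%:R * s.
Proof.
(* In dimension 0 the sign of [s] is unknown, but both sides vanish; otherwise some coordinate
   forces [0 <= s]. *)
have [d0 xs|d0 xs] := posnP d.
  rewrite [enorm x](_ : _ = 0) ?d0 ?mul0r//.
  by rewrite /enorm big1 ?sqrtr0// => -[i id]; exfalso; move: id; rewrite d0.
have s0 : 0 <= s by apply: le_trans (xs (Ordinal d0)).
rewrite -(@ler_pXn2r _ 2)// ?nnegrE ?enorm_ge0 ?mulr_ge0// sqr_enorm.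
apply: (@le_trans _ _ (\sum_(i < d) s ^+ 2)).
  by apply: ler_sum => i _; rewrite -real_normK ?num_real// ler_pXn2r ?nnegrE.
rewrite sumr_const card_ord -[_ *+ d]mulr_natl exprMn ler_wpM2r ?sqr_ge0//.
by rewrite expr2 ler_peMl// ler1n.
Qed.

(* With a = |x| and b = |y| positive, convexity of the square gives
   (x_i + y_i)^2 <= (a + b) (x_i^2 / a + y_i^2 / b); sum over i. *)
Lemma ler_enormD x y : enorm (x + y) <= enorm x + enorm y.
Proof.
have := enorm_ge0 x; rewrite le_eqVlt => /predU1P[/esym/enorm_eq0->|a0].
  by rewrite add0r enorm0 add0r.
have := enorm_ge0 y; rewrite le_eqVlt => /predU1P[/esym/enorm_eq0->|b0].
  by rewrite addr0 enorm0 addr0.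
rewrite -(@ler_pXn2r _ 2)// ?nnegrE ?addr_ge0 ?enorm_ge0// sqr_enorm.
have -> : (enorm x + enorm y) ^+ 2 =
    (enorm x + enorm y) * (enorm x ^+ 2 / enorm x + enorm y ^+ 2 / enorm y).
  by field; rewrite !gt_eqF.
rewrite !sqr_enorm !mulr_suml -big_split/= mulr_sumr.
apply: ler_sum => i _; rewrite mxE.
move: (enorm x) (enorm y) (x _ _) (y _ _) a0 b0 => a b s t a0 b0.
rewrite -subr_ge0 (_ : _ - _ = (b * s - a * t) ^+ 2 / (a * b)).
  by rewrite divr_ge0 ?sqr_ge0// ltW// mulr_gt0.
by field; rewrite !gt_eqF.
Qed.

Lemma cball0E s x : cball 0 s x = (enorm x <= s).
Proof. by rewrite /cball/= subr0. Qed.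

End Enorm.

(** * Translates of Delone sets and the local matching metric *)

Section Shift.
Context {K : realType} {d : nat}.
Implicit Types (x y : 'rV[K]_d) (w xi : set 'rV[K]_d) (S : K).

Lemma shiftE x w y : shift x w y = w (x + y).
Proof.
apply/propext; split => [[z wz <-]|wxy]; first by rewrite addrA subrr add0r.
by exists (x + y) => //; rewrite addKr.
Qed.

(** Both points lie in the open ball of radius [r] around their midpoint. *)
Lemma delone_separated r R w x y : delone r R w -> w x -> w y ->
  enorm (x - y) < 2 * r -> x = y.
Proof.
move=> [w1 _] wx wy xy; apply: (w1 (2^-1 *: (x + y))); split => //.
- rewrite /oball/= (_ : _ - _ = 2^-1 *: (x - y)); last first.
    by apply/rowP => i; rewrite !mxE; field.
  by rewrite enormZ ger0_norm// ltr_pdivrMl.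
- rewrite /oball/= (_ : _ - _ = 2^-1 *: (y - x)); last first.
    by apply/rowP => i; rewrite !mxE; field.
  by rewrite enormZ ger0_norm// ltr_pdivrMl// enormB.
Qed.

Lemma delone_shift r R x w : delone r R w -> delone r R (shift x w).
Proof.
move=> [w1 w2]; split => z.
  move=> a b [+ az] [+ bz]; rewrite !shiftE => wa wb.
  apply: (addrI x); apply: (w1 (x + z)); split => //.
    by move: az; rewrite /oball/= opprD addrACA subrr add0r.
  by move: bz; rewrite /oball/= opprD addrACA subrr add0r.
have [y [wy yz]] := w2 (x + z); exists (y - x); split.
  by rewrite shiftE addrC subrK.
by move: yz; rewrite /cball/= opprD addrA.
Qed.

Lemma delone_dist_le S xi1 xi2 u v : 0 < S -> enorm u <= S -> enorm v <= S ->
    (forall y, enorm y <= S^-1 -> xi1 (u + y) <-> xi2 (v + y)) ->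
  delone_dist xi1 xi2 <= S.
Proof.
move=> S0 uS vS h; rewrite /delone_dist; set X := ereal_inf _.
have XS : (X <= S%:E)%E.
  apply: ereal_inf_lbound; exists S => //; split => //; exists u, v.
  split; rewrite ?cball0E//; apply/seteqP; split => y [];
    rewrite shiftE cball0E => xiy yS;
    by split; rewrite ?shiftE ?cball0E//; apply/(h _ yS).
have X0 : (0 <= X)%E.
  by apply: le_ereal_inf_tmp => _ [s [/ltW s0 _]] <-; rewrite lee_fin.
case: X XS X0 => [x||]// xS x0; rewrite minEle lee_fin.
by have [h1|h1] := leP (Num.sqrt 2)^-1 x => //=; exact: le_trans h1 xS.
Qed.

(** Below the cap the distance is the infimum itself, so some admissible [s < S] exists; its
    matching on the larger ball of radius [s^-1] restricts to radius [S^-1]. *)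
Lemma delone_dist_lt S xi1 xi2 : 0 < S -> S <= (Num.sqrt 2)^-1 ->
    delone_dist xi1 xi2 < S ->
  exists u v, [/\ enorm u <= S, enorm v <= S &
    forall y, enorm y <= S^-1 -> xi1 (u + y) <-> xi2 (v + y)].
Proof.
move=> S0 S2; rewrite /delone_dist; set X := ereal_inf _ => dS.
have : (X < S%:E)%E.
  have X0 : (0 <= X)%E.
    by apply: le_ereal_inf_tmp => _ [s [/ltW s0 _]] <-; rewrite lee_fin.
  move: dS X0; case: X => [x||]//=.
    rewrite minEle lee_fin; case: (leP (Num.sqrt 2)^-1 x) => /= _.
      by rewrite ltNge S2.
    by rewrite lte_fin.
  by rewrite minEle leey/= ltNge S2.
move=> /ereal_inf_lt[_ [s [s0 [u [v [us vs uv]]]]] <-]; rewrite lte_fin => sS.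
exists u, v; split.
- by move: us; rewrite cball0E => /le_trans-> //; exact: ltW.
- by move: vs; rewrite cball0E => /le_trans-> //; exact: ltW.
- move=> y yS; have ys : enorm y <= s^-1.
    by rewrite (le_trans yS)// lef_pV2 ?posrE// ltW.
  move/seteqP: uv => [uv vu]; split => h.
  + by have := uv y; rewrite /setI/= !shiftE cball0E => /(_ (conj h ys))[].
  + by have := vu y; rewrite /setI/= !shiftE cball0E => /(_ (conj h ys))[].
Qed.

End Shift.

(** * Rigidity of local matchings along a ball *)

Section AgreementAlongPaths.
Context {K : realType} {d : nat}.
Variables (r R e : K).
Hypotheses (r_gt0 : 0 < r) (R_gt0 : 0 < R) (e_gt0 : 0 < e).
Hypotheses (e_sqrt2 : e < (Num.sqrt 2)^-1) (e_r : e < r / 2)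
  (e_R : e < (2 * R)^-1).
Implicit Types (x y p : 'rV[K]_d) (D : K).

(** Half the matching radius [e^-1]: it exceeds [R], so balls of this radius meet the sets, and a
    centre may still move by [e] inside the matching ball because [e ^+ 2 < 1/2]. *)
Let rho := (2 * e)^-1.

Let ltRrho : R < rho.
Proof.
have := e_R; rewrite /rho -[_^-1]div1r ltr_pdivlMr ?mulr_gt0// => h.
by rewrite -[_^-1]div1r ltr_pdivlMr ?mulr_gt0// (_ : R * _ = e * (2 * R)) //; ring.
Qed.

Let rho_e : rho + e <= e^-1.
Proof.
have e2 : e ^+ 2 < 2^-1.
  have -> : 2^-1 = ((Num.sqrt 2)^-1) ^+ 2 :> K by rewrite exprVn sqr_sqrtr.
  by rewrite ltr_pXn2r ?nnegrE ?invr_ge0 ?sqrtr_ge0// ltW.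
rewrite -subr_ge0 (_ : _ - _ = (2^-1 - e ^+ 2) / e).
  by rewrite divr_ge0 ?ltW// subr_gt0.
by rewrite /rho; field; rewrite gt_eqF.
Qed.

(* An offset is read off from a single common point, because 2e < r is below the
   separation 2r of the points of xi2.  It vanishes at the origin, and it goes on
   vanishing along a segment walked in steps of length at most rho - R, since
   consecutive balls of radius rho then share a point of xi1. *)
Lemma agree_of_close xi1 xi2 D : 0 <= D -> delone r R xi1 -> delone r R xi2 ->
    xi1 0 -> xi2 0 ->
    (forall x, enorm x <= D -> delone_dist (shift x xi1) (shift x xi2) < e) ->
  forall y, enorm y <= D -> xi1 y <-> xi2 y.
Proof.
move=> D0 del1 del2 xi10 xi20 close y yD.
have offset x : enorm x <= D -> exists2 t, enorm t <= 2 * e &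
    forall p, enorm (p - x) <= rho -> xi1 p <-> xi2 (p - t).
  move=> /close/(delone_dist_lt e_gt0 (ltW e_sqrt2))[u [v [ue ve uv]]].
  exists (u - v).
    by rewrite (le_trans (ler_enormD _ _))// enormN mulr2n mulrDl !mul1r lerD.
  move=> p px; have := uv (p - x - u); rewrite !shiftE.
  rewrite (_ : x + (u + _) = p); last by rewrite [u + _]addrC subrK addrC subrK.
  rewrite (_ : x + (v + _) = p - (u - v)); last first.
    by apply/rowP => i; rewrite !mxE; ring.
  apply; rewrite (le_trans (ler_enormD _ _))// enormN.
  by apply: le_trans rho_e; rewrite lerD.
have e2r : 2 * e < 2 * r by move: e_r r_gt0; lra.
pose good x := forall p, enorm (p - x) <= rho -> xi1 p <-> xi2 p.
have rho0 : 0 <= rho by rewrite ltW// (lt_trans R_gt0).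
have good0 : good 0.
  have [|t te xi12] := offset 0; first by rewrite enorm0.
  suff t0 : t = 0 by move=> p /xi12; rewrite t0 subr0.
  apply: (addrI (- t)); rewrite addrC subrr addr0.
  apply: (delone_separated del2 xi20).
    by rewrite -sub0r; apply/xi12 => //; rewrite subrr enorm0.
  by rewrite opprK add0r (le_lt_trans te).
have good_step x x' : good x -> enorm x' <= D -> enorm (x' - x) <= rho - R ->
    good x'.
  move=> gx x'D xx'; have [t te xi12] := offset _ x'D.
  have [p [xi1p]] := del1.2 x'; rewrite /cball/= => px'.
  have xi2p : xi2 p.
    apply/gx => //; rewrite -(subrK x' p) -addrA (le_trans (ler_enormD _ _))//.
    by rewrite -[rho](subrKC R) lerD.
  suff t0 : t = 0 by move=> q /xi12; rewrite t0 subr0.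
  apply: (addrI (- t)); rewrite [RHS]addr0 addrC subrr; apply/esym.
  apply: (addrI p); rewrite addr0.
  apply: (delone_separated del2) => //.
    by apply/xi12 => //; rewrite (le_trans px')// ltW.
  by rewrite addrAC subrr add0r enormN (le_lt_trans te).
(* Enough equal steps from 0 to [y] for each to have length at most [rho - R]; the successor keeps
   [N] nonzero. *)
pose N := (Num.truncn (enorm y / (rho - R))).+1.
have N0 : 0 < N%:R :> K by rewrite ltr0n.
have path k : (k <= N)%N -> good ((k%:R / N%:R) *: y).
  elim: k => [_|k IH kN]; first by rewrite mul0r scale0r.
  apply: (good_step _ _ (IH (ltnW kN))).
    rewrite enormZ ger0_norm ?divr_ge0// (le_trans _ yD)// ler_piMl ?enorm_ge0//.
    by rewrite ler_pdivrMr// mul1r ler_nat.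
  rewrite -scalerBl -mulrBl -natrB// subSnn mul1r enormZ.
  rewrite ger0_norm ?invr_ge0// ler_pdivrMl//.
  rewrite -ler_pdivrMr ?subr_gt0//.
  by rewrite ltW// truncnS_gt.
have := path N (leqnn _); rewrite divff ?gt_eqF// scale1r; apply.
by rewrite subrr enorm0.
Qed.

End AgreementAlongPaths.

(** * Comparison of cardinalities *)

Section Counting.
Context {K : realType}.

Lemma counting_le (T U : choiceType) (A : set T) (B : set U) :
  (A #<= B)%card -> (counting A <= counting B :> \bar K)%E.
Proof.
move=> AB; rewrite /counting; case: (asboolP (finite_set B)) => [fB|_]; last first.
  by rewrite leey.
rewrite asboolT; last exact: card_le_finite fB.
have /finite_setP[n Bn] := fB.
rewrite (card_fset_set Bn) lee_fin ler_nat; apply: geq_card_fset_set.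
by apply: card_le_trans AB _; by move/card_eqPle: Bn => [].
Qed.

Lemma counting_ge1 (T : choiceType) (A : set T) :
  A !=set0 -> (1 <= counting A :> \bar K)%E.
Proof.
move=> [a Aa]; apply: (@le_trans _ _ (counting [set a])).
  by rewrite /counting asboolT// fset_set1 finmap.cardfs1.
by apply/counting_le/subset_card_le => _ ->.
Qed.

(** The pair of [f] and [c] injects [A] into the product of [B] and [F]; later [f] reads off a patch
    and [c] a grid cell. *)
Lemma counting_le_mul (T U : choiceType) (F : finType) (A : set T) (B : set U)
    (f : T -> U) (c : T -> F) :
    finite_set B -> (forall t, A t -> B (f t)) ->
    (forall s t, A s -> A t -> f s = f t -> c s = c t -> s = t) ->
  (counting A <= #|F|%:R%:E * counting B :> \bar K)%E.
Proof.
move=> fB AB inj; pose g t := (f t, c t).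
have fA : finite_set A.
  have gA : {in A &, injective g}.
    by move=> s t /set_mem As /set_mem At [fst cst]; exact: inj.
  rewrite -(eq_finite_set (inj_card_eq gA)).
  apply: (@sub_finite_set _ _ (B `*` [set: F])).
    by move=> _ [t At <-]; split => //=; exact: AB.
  by apply: finite_setX => //; exact: finite_finset.
rewrite /counting !asboolT// -EFinM lee_fin -natrM ler_nat mulnC cardE.
rewrite -(size_allpairs pair) -(size_map g); apply: uniq_leq_size.
  rewrite map_inj_in_uniq ?finmap.fset_uniq// => s t.
  rewrite !in_fset_set// => /set_mem As /set_mem At [fst cst].
  exact: inj.
move=> _ /mapP[t + ->]; rewrite in_fset_set// => /set_mem At.
apply: allpairs_f; last by rewrite mem_enum.
by rewrite in_fset_set//; apply/mem_set/AB.
Qed.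

End Counting.

(** * Limits superior of extended real sequences *)

Section Limsup.
Context {K : realType}.
Implicit Types u : nat -> \bar K.

Lemma limn_esup_le_near u L N :
  (forall n, (N <= n)%N -> (u n <= L)%E) -> (limn_esup u <= L)%E.
Proof.
move=> uL; apply: (@le_trans _ _ (ereal_sup (u @` [set n | (N <= n)%N]))).
  apply: ereal_inf_lbound; exists [set n | (N <= n)%N] => //.
  exact: nbhs_infty_ge.
by apply: ge_ereal_sup => _ [n Nn <-]; exact: uL.
Qed.

Lemma limn_esup_lt_near u L : (limn_esup u < L)%E ->
  exists N, forall n, (N <= n)%N -> (u n <= L)%E.
Proof.
move=> /ereal_inf_lt[_ [V [N _ NV] <-] /ltW supL]; exists N => n Nn.
by apply: le_trans supL; apply: ereal_sup_ubound; exists n => //; exact: NV.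
Qed.

Lemma limn_esup_ge0 u : (forall n, (0 <= u n)%E) -> (0 <= limn_esup u)%E.
Proof.
move=> u0; apply: le_ereal_inf_tmp => _ [V [N _ NV] <-].
apply: le_ereal_sup_tmp; exists (u N) => //.
by exists N => //; exact/NV/leqnn.
Qed.

End Limsup.

(** * Volume scaling and exponential growth rates *)

Section LogGrowth.
Context {K : realType} {d : nat}.
Implicit Types (A B : set 'rV[K]_d) (s : K) (c : nat -> \bar K).

(** Dilating a box cover of [A] by [s] covers [B] and multiplies each box volume by [s ^+ d]. *)
Lemma lebesgue_volume_scale_le A B s : 0 < s ->
    (forall x, B x -> A (s^-1 *: x)) ->
  (lebesgue_volume B <= (s ^+ d)%:E * lebesgue_volume A)%E.
Proof.
move=> s0 BA; rewrite -lee_pdivrMl ?exprn_gt0//.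
apply: le_ereal_inf_tmp => _ [a [b [ab Aab ->]]].
rewrite lee_pdivrMl ?exprn_gt0//; apply: ereal_inf_lbound.
exists (fun k => s *: a k), (fun k => s *: b k); split.
- by move=> k i /=; rewrite !mxE ler_pM2l.
- move=> x /BA/Aab[k _ kx]; exists k => // i /=; rewrite !mxE.
  by have := kx i; rewrite mxE ler_pdivlMl// ler_pdivrMl.
- rewrite -nneseriesZl; last first.
    by move=> k _; rewrite lee_fin prodr_ge0// => i _; rewrite subr_ge0.
  apply: eq_eseriesr => k _; rewrite -EFinM; congr (_%:E).
  rewrite [RHS](eq_bigr (fun i => s * (b k ord0 i - a k ord0 i))); last first.
    by move=> i _; rewrite !mxE mulrBr.
  by rewrite big_split/= prodr_const card_ord.
Qed.

Lemma lebesgue_volume_cball s : 0 < s ->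
  lebesgue_volume (cball (0 : 'rV[K]_d) s) =
  ((s ^+ d)%:E * lebesgue_volume (cball (0 : 'rV[K]_d) 1))%E.
Proof.
move=> s0; apply/eqP; rewrite eq_le; apply/andP; split.
  apply: lebesgue_volume_scale_le => // x; rewrite !cball0E enormZ.
  by rewrite ger0_norm ?invr_ge0 ?(ltW s0)// ler_pdivrMl// mulr1.
rewrite -lee_pdivlMl ?exprn_gt0// -exprVn.
apply: lebesgue_volume_scale_le => [|x]; rewrite ?invr_gt0// !cball0E enormZ.
by rewrite invrK ger0_norm ?(ltW s0)// => x1; rewrite ler_piMr// ltW.
Qed.

Lemma fine_volume_cball_nat n : (0 < n)%N ->
  fine (lebesgue_volume (cball (0 : 'rV[K]_d) n%:R)) =
  n%:R ^+ d * fine (lebesgue_volume (cball (0 : 'rV[K]_d) 1)).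
Proof.
move=> n0; rewrite lebesgue_volume_cball ?ltr0n//.
have nd0 : 0 < n%:R ^+ d :> K by rewrite exprn_gt0// ltr0n.
(* [fine] sends infinite values to 0, so both sides are 0 in those cases. *)
case: lebesgue_volume => [v//||] /=.
- by rewrite gt0_muley ?lte_fin//= mulr0.
- by rewrite gt0_muleNy ?lte_fin//= mulr0.
Qed.

Lemma lebesgue_volume_ge0 A : (0 <= lebesgue_volume A)%E.
Proof.
apply: le_ereal_inf_tmp => _ [a [b [ab _ ->]]].
apply: nneseries_ge0 => k _ _; rewrite lee_fin prodr_ge0// => i _.
by rewrite subr_ge0.
Qed.

(* The inverse W of the volume of the unit ball is a constant: nothing but W >= 0
   is used, so that neither the finiteness nor the positivity of that volume
   matters. *)
Lemma log_growth_le (c c' : nat -> \bar K) (C : K) (k : nat) :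
    (0 < d)%N -> 1 <= C -> (forall n, (1 <= c n)%E) ->
    (forall n, (0 <= c' n)%E) ->
    (forall n, (0 < n)%N -> (c' n <= C%:E * c (n + k)%N)%E) ->
  (log_growth d c' <= log_growth d c)%E.
Proof.
move=> d0 C1 c1 c'0 c'c; rewrite /log_growth.
set W := (fine (lebesgue_volume (cball (0 : 'rV[K]_d) 1)))^-1.
have W0 : 0 <= W by rewrite invr_ge0 fine_ge0// lebesgue_volume_ge0.
have volE n : (0 < n)%N ->
    (fine (lebesgue_volume (cball (0 : 'rV[K]_d) n%:R)))^-1 =
    W * n%:R^-1 ^+ d.
  by move=> n0; rewrite fine_volume_cball_nat// invfM exprVn mulrC.
set u := (X in (_ <= limn_esup X)%E); set u' := (X in (limn_esup X <= _)%E).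
have u0 n : (0 <= u n)%E.
  apply: mule_ge0; last by rewrite lne_ge0.
  by rewrite lee_fin invr_ge0 fine_ge0// lebesgue_volume_ge0.
have := limn_esup_ge0 u0; case lE : (limn_esup u) => [l||]//; last first.
  by move=> _; rewrite leey.
move=> _; apply/lee_addgt0Pr => eps eps0.
pose M := l + eps / 2.
have [N NM] : exists N, forall n, (N <= n)%N -> (u n <= M%:E)%E.
  by apply: limn_esup_lt_near; rewrite lE lte_fin ltrDl divr_gt0.
(* At [t = 1/n] this bounds the [n]-th term of [u']: the first summand comes from [C], the second
   from the volume ratio of the balls of radii [n + k] and [n]. Since [d > 0], [g 0 = M]. *)
pose g (t : K) := W * ln C * t ^+ d + (1 + k%:R * t) ^+ d * M.
have gM : g t @[t --> 0] --> M.
  rewrite [X in _ --> X](_ : M = g 0); last first.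
    by rewrite /g expr0n gtn_eqF// !mulr0 add0r addr0 expr1n mul1r.
  apply: cvgD; first by apply: cvgM; [exact: cvg_cst|exact: exprn_continuous].
  apply: cvgM; last exact: cvg_cst.
  apply: (cvg_comp (fun t : K => 1 + k%:R * t) (fun t => t ^+ d)); last first.
    exact: exprn_continuous.
  apply: cvgD; first exact: cvg_cst.
  by apply: cvgM; [exact: cvg_cst|exact: cvg_id].
have ltM : M < l + eps by rewrite ltrD2l ltr_pdivrMr// mulr_natr mulr2n ltrDl.
have gL : \forall t \near (0 : K), g t < l + eps by exact: cvgr_lt gM _ ltM.
have [del /= del0 gdel] := (nbhs_ballP _ _).1 gL.
apply: (@limn_esup_le_near _ _ _ (maxn N (Num.truncn del^-1).+1)) => n.
rewrite geq_max => /andP[Nn dn].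
have n0 : (0 < n)%N by rewrite (leq_trans _ dn).
have nR0 : 0 < n%:R :> K by rewrite ltr0n.
apply: (@le_trans _ _ (g n%:R^-1)%:E); last first.
  rewrite -EFinD lee_fin ltW// gdel// -ball_normE/= sub0r normrN.
  rewrite ger0_norm ?invr_ge0 ?(ltW nR0)// invf_plt ?posrE//.
  by apply: lt_le_trans (truncnS_gt _) _; rewrite ler_nat.
rewrite /u' volE//.
apply: (@le_trans _ _ ((W * n%:R^-1 ^+ d)%:E * lne (C%:E * c (n + k)%N))%E).
  apply: lee_wpmul2l; first by rewrite lee_fin mulr_ge0// exprn_ge0// invr_ge0.
  rewrite lee_lne ?in_itv/= ?andbT ?leey ?c'0 ?c'c//.
  by rewrite mule_ge0 ?lee_fin ?(le_trans ler01)// (le_trans _ (c1 _)).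
have lC : (lne C%:E = (ln C)%:E)%E.
  by rewrite lne_EFin// (lt_le_trans ltr01).
rewrite lneM; last 2 first.
- by rewrite in_itv/= leey lte_fin (lt_le_trans ltr01).
- by rewrite in_itv/= leey (lt_le_trans _ (c1 _)).
rewrite lC ge0_muleDr ?lee_fin ?ln_ge0 ?lne_ge0// /g EFinD leeD//.
  by rewrite -EFinM lee_fin mulrAC.
have nk0 : 0 < (n + k)%:R :> K by rewrite ltr0n addn_gt0 n0.
have -> : W * n%:R^-1 ^+ d =
    (1 + k%:R * n%:R^-1) ^+ d * (W * (n + k)%:R^-1 ^+ d).
  rewrite (_ : 1 + _ = (n + k)%:R / n%:R); last first.
    by rewrite natrD; field; rewrite gt_eqF.
  rewrite exprMn mulrCA [_ ^+ d * _ * _]mulrAC -exprMn divff ?gt_eqF//.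
  by rewrite expr1n mul1r.
rewrite !EFinM -muleA -EFinM -volE ?addn_gt0 ?n0//.
apply: lee_wpmul2l; last exact: NM (leq_trans Nn (leq_addr _ _)).
by rewrite lee_fin exprn_ge0// addr_ge0// mulr_ge0// invr_ge0.
Qed.

End LogGrowth.

(** * Patches against separated sets in the hull *)

Section DeloneEntropy.
Context {K : realType} {d : nat}.
Variables (r R : K) (w : set 'rV[K]_d).
Hypotheses (r_gt0 : 0 < r) (R_gt0 : 0 < R).
Hypotheses (w_delone : delone r R w) (w_flc : flc w).
Implicit Types (e M : K) (n : nat) (xi : set 'rV[K]_d).

Lemma hull_shift x : hull r R w (shift x w).
Proof.
split; first exact: delone_shift.
move=> e e0; exists x; apply: (@le_lt_trans _ _ (e / 2)).
  apply: (@delone_dist_le _ _ _ _ _ 0 0);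
    by rewrite ?divr_gt0 ?enorm0 ?divr_ge0// ltW.
by rewrite ltr_pdivrMr// mulr_natr mulr2n ltrDl.
Qed.

Lemma counting_patches_ge1 M : (1 <= counting (patches w M) :> \bar K)%E.
Proof.
have [x [wx _]] := w_delone.2 0.
by apply: counting_ge1; exists (shift x w `&` cball 0 M); exists x.
Qed.

Lemma hull_patches xi q M : hull r R w xi -> xi q -> enorm q <= R -> 0 <= M ->
  patches w M (shift q xi `&` cball 0 M).
Proof.
(* The matching radius [M + R + 2] has room for [q], for a translation [u] of length at most 1 and
   for the patch; it also brings [S] below the cap of the metric. *)
move=> [_ xiw] xiq qR M0; pose S := (M + R + 2)^-1.
have MR0 : 0 < M + R + 2 by rewrite addr_gt0// ltr_wpDl.
have S0 : 0 < S by rewrite invr_gt0.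
have S1 : S <= 1 by rewrite invf_le1//; move: R_gt0 M0; lra.
have S2 : S <= (Num.sqrt 2)^-1.
  rewrite lef_pV2 ?posrE ?sqrtr_gt0//.
  apply: (@le_trans _ _ 2); last by move: R_gt0 M0; lra.
  by rewrite -(@ler_pXn2r _ 2)// ?nnegrE ?sqrtr_ge0// sqr_sqrtr// ler_eXnr// ler1n.
have [x /(delone_dist_lt S0 S2)[u [v [uS vS uv]]]] := xiw _ S0.
have near y : enorm y <= M -> xi (q + y) <-> w (x + (v + (q - u)) + y).
  move=> yM; have := uv (q - u + y); rewrite shiftE.
  rewrite (_ : u + (q - u + y) = q + y); last first.
    by apply/rowP => i; rewrite !mxE; ring.
  rewrite (_ : x + (v + (q - u + y)) = x + (v + (q - u)) + y); last first.
    by rewrite !addrA.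
  apply; rewrite (le_trans (ler_enormD _ _))// invrK.
  have := ler_enormD q (- u); rewrite enormN.
  by move: yM qR uS S1; lra.
exists (x + (v + (q - u))).
  have := near 0; rewrite !addr0 enorm0 => h.
  by have := (h M0).1 xiq.
apply/seteqP; split => y [+ yM]; rewrite shiftE => h; split => //;
  rewrite shiftE; apply/near => //; by rewrite -cball0E.
Qed.

Lemma sep_number_ge_patches n e : 0 < e ->
    e < Num.min (Num.sqrt 2)^-1 (Num.min (r / 2) (2 * R)^-1) ->
  (counting (patches w n%:R) <= sep_number (hull r R w) n%:R e)%E.
Proof.
move=> e0; set e1 := Num.min _ _ => ee1.
(* Failure of separation only gives distance at most [e], while [agree_of_close] asks for a strict
   bound; a slightly larger scale still below [e1] provides it. *)
pose e' := (e + e1) / 2.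
have [ee' e'1] : e < e' /\ e' < e1 by rewrite /e'; split; lra.
have e'0 : 0 < e' by exact: lt_trans ee'.
have : e' < e1 by []; rewrite /e1 !lt_min => /and3P[e'2 e'r e'R].
pose centre P := xget 0 [set x | w x /\ shift x w `&` cball 0 n%:R = P].
have centreP P : patches w n%:R P ->
    w (centre P) /\ shift (centre P) w `&` cball 0 n%:R = P.
  move=> [x wx xP].
  suff /(xgetPex 0) :
      exists x, [set x | w x /\ shift x w `&` cball 0 n%:R = P] x by [].
  by exists x.
pose Xi := [set shift (centre P) w | P in patches w n%:R].
apply: (@le_trans _ _ (counting Xi)).
  apply: counting_le.
  (* Cutting the members of [Xi] down to the ball recovers every patch. *)
  apply: card_le_trans (card_image_le (fun xi => xi `&` cball 0 n%:R) Xi).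
  apply: subset_card_le => P wP; exists (shift (centre P) w); first by exists P.
  by have [] := centreP _ wP.
apply: ereal_sup_ubound; exists Xi => //; split.
  by move=> _ [P _ <-]; exact: hull_shift.
move=> _ _ [P wP <-] [Q wQ <-] PQ; apply: contrapT => close; apply: PQ.
suff -> : P = Q by [].
have [wcP {1}<-] := centreP _ wP; have [wcQ {1}<-] := centreP _ wQ.
have agree : forall y, enorm y <= n%:R ->
    shift (centre P) w y <-> shift (centre Q) w y.
  apply: (agree_of_close r_gt0 R_gt0 e'0) => //.
  - exact: delone_shift.
  - exact: delone_shift.
  - by rewrite shiftE addr0.
  - by rewrite shiftE addr0.
  - move=> x xn; apply: le_lt_trans ee'; rewrite leNgt; apply/negP => ex.
    by apply: close; exists x; rewrite ?cball0E.
by apply/seteqP; split => y [+ yn] => h; split => //; apply/agree => //;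
  rewrite -cball0E.
Qed.

Lemma separated_same_patch M e xi1 xi2 (q1 q2 : 'rV[K]_d) D : 0 < e ->
    enorm q2 <= R -> enorm (q1 - q2) <= e -> D + R + e^-1 <= M ->
    shift q1 xi1 `&` cball 0 M = shift q2 xi2 `&` cball 0 M ->
  forall x, enorm x <= D -> delone_dist (shift x xi1) (shift x xi2) <= e.
Proof.
move=> e0 q2R q12 DM same x xD.
apply: (@delone_dist_le _ _ _ _ _ (q1 - q2) 0) => //; first by rewrite enorm0 ltW.
move=> y ye; rewrite !shiftE add0r.
rewrite (_ : x + (q1 - q2 + y) = q1 + (x - q2 + y)); last first.
  by apply/rowP => i; rewrite !mxE; ring.
rewrite (_ : x + y = q2 + (x - q2 + y)); last first.
  by apply/rowP => i; rewrite !mxE; ring.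
have pM : cball 0 M (x - q2 + y).
  rewrite cball0E; have := ler_enormD (x - q2) y.
  have := ler_enormD x (- q2); rewrite enormN.
  by move: DM xD q2R ye; lra.
rewrite -(shiftE q1) -(shiftE q2); move/seteqP: same => [h12 h21].
by split => h; [have [] := h12 _ (conj h pM)|have [] := h21 _ (conj h pM)].
Qed.

Lemma sep_number_le_patches e : 0 < e -> exists (C : K) (k : nat),
  1 <= C /\ forall n,
    (sep_number (hull r R w) n%:R e <=
      C%:E * counting (patches w (n + k)%:R))%E.
Proof.
(* Points of one cell differ by at most [del] in each coordinate, hence by at most [d * del <= e] in
   norm. *)
move=> e0; pose del := e / d.+1%:R.
have del0 : 0 < del by rewrite divr_gt0.
pose N := Num.truncn (2 * R / del).
(* For [q] in the ball of radius [R] the rescaled coordinates lie between 0 and [2 * R / del], so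
   [inord] never meets its default. *)
pose cell (q : 'rV[K]_d) : {ffun 'I_d -> 'I_N.+1} :=
  [ffun i => inord (Num.truncn ((q ord0 i + R) / del))].
have cell_close q1 q2 : enorm q1 <= R -> enorm q2 <= R -> cell q1 = cell q2 ->
    enorm (q1 - q2) <= e.
  move=> q1R q2R q12; apply: (@le_trans _ _ (d%:R * del)); last first.
    by rewrite /del mulrCA ler_piMr ?(ltW e0)// ler_pdivrMr// mul1r ler_nat.
  apply: enorm_le_coord => i; move/ffunP: q12 => /(_ i); rewrite !ffunE.
  have bound q : enorm q <= R -> 0 <= (q ord0 i + R) / del <= 2 * R / del.
    move=> qR; have := le_trans (coord_le_enorm q i) qR.
    rewrite ler_norml => /andP[qi1 qi2].
    rewrite divr_ge0 ?(ltW del0) ?ler_pM2r ?invr_gt0//=; move: qi1 qi2; lra.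
  have /andP[a0 aR] := bound _ q1R; have /andP[b0 bR] := bound _ q2R.
  move=> /(congr1 val); rewrite /= !inordK ?ltnS ?le_truncn// => ab.
  have /andP[a1 a2] := truncn_itv a0; have /andP[b1 b2] := truncn_itv b0.
  rewrite ab in a1 a2; rewrite !mxE.
  rewrite -[del]mul1r -ler_pdivrMr// -[X in _ / X](gtr0_norm del0) -normf_div.
  rewrite (_ : _ / del = (q1 ord0 i + R) / del - (q2 ord0 i + R) / del); last first.
    by field; rewrite gt_eqF.
  rewrite -natr1 in a2 b2; rewrite ler_norml.
  by move: a1 a2 b1 b2; set t := _%:R; set a := _ / _; set b := _ / _; lra.
(* The margin required by [separated_same_patch]; the successor also keeps [n + k] positive at
   [n = 0], as [flc] asks. *)
pose k := (Num.truncn (e^-1 + R)).+1.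
have kR : R + e^-1 <= k%:R by rewrite addrC ltW// truncnS_gt.
exists #|{ffun 'I_d -> 'I_N.+1}|%:R, k; split.
  by rewrite ler1n; apply/card_gt0P; exists (cell 0).
move=> n; apply: ge_ereal_sup => _ [Xi [Xihull Xisep] <-].
pose q xi := xget 0 (xi `&` cball 0 R).
have qP xi : Xi xi -> xi (q xi) /\ enorm (q xi) <= R.
  move=> /Xihull[[_ /(_ 0) xi0] _]; rewrite -cball0E.
  exact: (xgetPex 0 xi0).
apply: (@counting_le_mul _ _ _ _ _ _
  (fun xi => shift (q xi) xi `&` cball 0 (n + k)%:R) (fun xi => cell (q xi))).
- by apply: w_flc; rewrite ltr0n addn_gt0 orbT.
- move=> xi xiXi; have [xiq qR] := qP _ xiXi.
  exact: hull_patches (Xihull _ xiXi) xiq qR _.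
- move=> xi1 xi2 Xi1 Xi2 same samecell; apply: contrapT => /(Xisep _ _ Xi1 Xi2).
  move=> [x]; rewrite cball0E => xn; apply/negP; rewrite -leNgt.
  have [_ q1R] := qP _ Xi1; have [_ q2R] := qP _ Xi2.
  apply: separated_same_patch (cell_close _ _ q1R q2R samecell) _ same _ xn => //.
  by rewrite natrD -addrA lerD2l.
Qed.

End DeloneEntropy.

(** * Equality of the two entropies *)

Theorem theorem1 (K : realType) (d : nat) (r R : K) (w : set 'rV[K]_d) :
  (0 < d)%N -> 0 < r -> r <= R -> delone r R w -> flc w ->
  (forall e : K,
     0 < e -> e < Num.min (Num.sqrt 2)^-1 (Num.min (r / 2) (2 * R)^-1) ->
     entropy_at (hull r R w) e = patch_entropy w) /\
  patch_entropy w = top_entropy (hull r R w).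
Proof.
move=> d0 r0 rR delw flcw; have R0 : 0 < R by exact: lt_le_trans rR.
have entropyE e : 0 < e ->
    e < Num.min (Num.sqrt 2)^-1 (Num.min (r / 2) (2 * R)^-1) ->
    entropy_at (hull r R w) e = patch_entropy w.
  move=> e0 ee0.
  have patch1 n := counting_patches_ge1 delw n%:R.
  have sep_ge n := sep_number_ge_patches r0 R0 delw n e0 ee0.
  have sep1 n := le_trans (patch1 n) (sep_ge n).
  have ge0 (c : nat -> \bar K) : (forall n, (1 <= c n)%E) ->
      forall n, (0 <= c n)%E by move=> c1 n; exact: le_trans (c1 n).
  apply/eqP; rewrite eq_le; apply/andP; split.
    have [C [k [C1 sep_le]]] := sep_number_le_patches r R0 flcw e0.
    exact: (log_growth_le d0 C1 patch1 (ge0 _ sep1) (fun n _ => sep_le n)).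
  apply: (log_growth_le (k := 0) d0 (lexx 1) sep1 (ge0 _ patch1)) => n _.
  by rewrite mul1e addn0.
(* The entropy at scale [e] is constant on a right neighbourhood of 0. *)
split=> //; rewrite /top_entropy; apply/esym/lim_near_cst.
  exact: ereal_hausdorff.
near=> e; apply: entropyE; first by near: e; exact: nbhs_right_gt.
near: e; apply: nbhs_right_lt.
by rewrite !lt_min !invr_gt0 sqrtr_gt0 ltr0n divr_gt0// mulr_gt0.
Unshelve. all: by end_near.
Qed.
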